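(* Let $q$, $m$ and $n$ be positive integers such that $q$ is odd and $nm$ is even. Then \[ \sum_{k = 1}^\infty \frac{(-1)^{k-1}}{\prod_{j=0}^{m-1} L_{nk+njq}\,\prod_{j=m+1}^{2m} L_{nk+njq}} = \frac{1}{L_{mnq}}\sum_{k=1}^{q}\frac{(-1)^{k-1}}{\prod_{j=0}^{2m-1}L_{nk+njq}}. \]
   Context: The Lucas numbers are defined by $L_0=2$, $L_1=1$, $L_n=L_{n-1}+L_{n-2}$. Infinite sums are limits of partial sums. *)

(* Defs.v *)
From mathcomp Require Import all_boot.

Set Implicit Arguments.
Unset Strict Implicit.
Unset Printing Implicit Defensive.

Fixpoint lucas (n : nat) : nat :=
  match n with
  | 0 => 2
  | 1 => 1
  | (n1.+1 as n2).+1 => lucas n2 + lucas n1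
  end.

(* Main.v *)
(** Put [f k = (-1)^(k-1) / prod_(j < 2m) L_(nk+njq)].  As [q] is odd, over the
    common denominator [prod_(j <= 2m) L_(nk+njq)] the difference
    [f k - f (k + q)] has numerator [(-1)^(k-1) (L_(nk+2mnq) + L_(nk))].  As
    [mnq] is even, this equals [(-1)^(k-1) L_(mnq) L_(nk+mnq)], so the [k]-th
    summand of the series is [(f k - f (k + q)) / L_(mnq)].  The series
    telescopes with step [q], and [f] tends to [0]. *)
Require Import Defs.
From mathcomp Require Import all_boot all_order all_algebra.
From mathcomp Require Import all_classical all_reals all_analysis.
From mathcomp Require Import ring zify.

Import Order.TTheory GRing.Theory Num.Theory.
Import numFieldNormedType.Exports.

Local Open Scope classical_set_scope.
Local Open Scope ring_scope.

Lemma lucasSS (n : nat) : lucas n.+2 = (lucas n.+1 + lucas n)%N.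
Proof. by []. Qed.

(** The two bounds are proved jointly, at two consecutive indices: the recurrence reaches back two
    steps, and the growth bound gains its extra 1 from positivity of [lucas n]. *)
Lemma lucas_gt0_and_ge (n : nat) : (0 < lucas n)%N && (n <= lucas n)%N.
Proof.
suff: [&& (0 < lucas n)%N, (n <= lucas n)%N, (0 < lucas n.+1)%N
        & (n.+1 <= lucas n.+1)%N] by case/and4P=> -> ->.
elim: n => // n /and4P[h1 h2 h3 h4]; rewrite lucasSS; lia.
Qed.

Lemma lucas_gt0 (n : nat) : (0 < lucas n)%N.
Proof. by case/andP: (lucas_gt0_and_ge n). Qed.

Lemma leq_lucas (n : nat) : (n <= lucas n)%N.
Proof. by case/andP: (lucas_gt0_and_ge n). Qed.

(** Two-step induction on [b] with [a] free: expanding $L_{b+2}$ gives the instances $(a+1, b+1)$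
    and $(a+2, b)$, whose sign terms combine through $L_{a+2} - L_{a+1} = L_a$. *)
Lemma lucas_mul (R : comPzRingType) (a b : nat) :
  (lucas b)%:R * (lucas (a + b))%:R
    = (lucas (a + 2 * b))%:R + (-1) ^+ b * (lucas a)%:R :> R.
Proof.
suff: forall a, (lucas b)%:R * (lucas (a + b))%:R
        = (lucas (a + 2 * b))%:R + (-1) ^+ b * (lucas a)%:R :> R
      /\ (lucas b.+1)%:R * (lucas (a + b.+1))%:R
        = (lucas (a + 2 * b.+1))%:R + (-1) ^+ b.+1 * (lucas a)%:R :> R.
  by move=> /(_ a)[].
elim: b {a} => [|b IHb] a.
  rewrite muln0 muln1 addn0 addn1 addn2 lucasSS natrD /=; split; ring.
split; first by case: (IHb a).
have [_ h1] := IHb a.+1; have [h0 _] := IHb a.+2.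
rewrite [lucas b.+2]lucasSS natrD mulrDl.
rewrite (_ : (a + b.+2 = a.+1 + b.+1)%N); last by lia.
rewrite h1 (_ : (a.+1 + b.+1 = a.+2 + b)%N); last by lia.
rewrite h0 (_ : (a + 2 * b.+2 = (a + 2 * b).+4)%N); last by lia.
rewrite (_ : (a.+1 + 2 * b.+1 = (a + 2 * b).+3)%N); last by lia.
rewrite (_ : (a.+2 + 2 * b = (a + 2 * b).+2)%N); last by lia.
rewrite (lucasSS (a + 2 * b).+2) (lucasSS a) !natrD !exprS; ring.
Qed.

(** The partial sum is the first [q] terms minus the window $u_{N+1}, \dots, u_{N+q}$, whose fixed
    number of terms all tend to 0. *)
Lemma cvg_telescope_step (R : realType) (q : nat) (u : nat -> R) :
  u @ \oo --> (0 : R) ->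
  (fun N : nat => \sum_(1 <= k < N.+1) (u k - u (k + q)%N)) @ \oo -->
  (\sum_(1 <= k < q.+1) u k : R).
Proof.
move=> u0.
have -> : (fun N : nat => \sum_(1 <= k < N.+1) (u k - u (k + q)%N)) =
    (fun N : nat => \sum_(1 <= k < q.+1) u k - \sum_(i < q) u (N + i.+1)%N).
  apply/funext; elim=> [|N IHN].
    by rewrite big_geq// big_add1 big_mkord subrr.
  rewrite big_nat_recr//= IHN -addrA; congr (_ + _).
  (* Sliding the window by one gains its new last term and loses its old first one. *)
  have tele : \sum_(i < q) u (N.+1 + i.+1)%N
      = \sum_(i < q) u (N + i.+1)%N + u (N.+1 + q)%N - u N.+1.
    have := @telescope_sumr R 0 q (fun i => u (N.+1 + i)%N) isT.
    rewrite sumrB !big_mkord addn0 => /(canRL (subrK _)) ->.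
    rewrite addrC addrA; congr (_ + _ - _).
    by apply: eq_bigr => i _; rewrite addSnnS.
  by rewrite tele; ring.
rewrite -[X in _ --> X]subr0; apply: cvgB; first exact: cvg_cst.
rewrite [X in _ --> X](_ : _ = \sum_(i < q) 0); last by rewrite big1.
apply: (cvg_big add_continuous) => i _.
by rewrite (cvg_shiftn i.+1 u).
Qed.

(** The bound starts at index 1: since [0^-1 = 0], a bound at index 0 would force [u 0 = 0]. *)
Lemma cvg0_le_inv (R : realType) (u : nat -> R) :
  (forall k, `|u k.+1| <= k.+1%:R^-1) -> u @ \oo --> (0 : R).
Proof.
move=> hu; rewrite -(cvg_shiftS u); apply/norm_cvg0P.
apply: (squeeze_cvgr _ (cvg_cst 0) (@cvg_harmonic R)).
by apply: nearW => k /=; rewrite normr_ge0 hu.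
Qed.

Theorem theorem2p15 (R : realType) (q m n : nat)
    (q_gt0 : (0 < q)%N) (m_gt0 : (0 < m)%N) (n_gt0 : (0 < n)%N)
    (q_odd : odd q) (nm_even : ~~ odd (n * m)%N) :
  (fun N : nat =>
     \sum_(1 <= k < N.+1)
        ((-1) ^+ (k - 1)%N /
         ((\prod_(0 <= j < m) (lucas (n * k + n * j * q)%N)%:R) *
          (\prod_(m.+1 <= j < (2 * m).+1) (lucas (n * k + n * j * q)%N)%:R)) : R))
    @ \oo -->
  (1 / (lucas (m * n * q)%N)%:R *
   \sum_(1 <= k < q.+1)
      ((-1) ^+ (k - 1)%N /
       \prod_(0 <= j < 2 * m) (lucas (n * k + n * j * q)%N)%:R) : R).
Proof.
pose l k j : R := (lucas (n * k + n * j * q)%N)%:R.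
pose f k : R := (-1) ^+ (k - 1)%N / \prod_(0 <= j < 2 * m) l k j.
pose c : R := (lucas (m * n * q)%N)%:R.
have c_neq0 : c != 0 by rewrite pnatr_eq0 -lt0n lucas_gt0.
have l_neq0 k j : l k j != 0 by rewrite pnatr_eq0 -lt0n lucas_gt0.
have prod_neq0 k a b : \prod_(a <= j < b) l k j != 0.
  by rewrite prodf_seq_neq0; apply/allP => j _; rewrite l_neq0.
have f_cvg0 : f @ \oo --> (0 : R).
  apply: cvg0_le_inv => k.
  rewrite /f normrM normrX normrN1 expr1n mul1r normfV.
  rewrite lef_pV2 ?posrE ?normr_gt0 ?ltr0n//.
  (* The factor [j = 0] alone is at least the index [k.+1]; the remaining factors are positive
     integers. *)
  rewrite /l -natr_prod normr_nat ler_nat big_ltn ?muln_gt0//.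
  rewrite muln0 mul0n addn0 (leq_trans _ (leq_pmulr _ _))//.
    by rewrite (leq_trans _ (leq_lucas _))// leq_pmull.
  by rewrite prodn_gt0// => j; apply: lucas_gt0.
have term_eq k : (0 < k)%N -> (-1) ^+ (k - 1)%N /
    ((\prod_(0 <= j < m) l k j) * (\prod_(m.+1 <= j < (2 * m).+1) l k j))
    = c^-1 * (f k - f (k + q)%N).
  move=> k_gt0.
  set A := \prod_(0 <= j < m) l k j.
  set B := \prod_(m.+1 <= j < (2 * m).+1) l k j.
  have full : \prod_(0 <= j < (2 * m).+1) l k j = A * (l k m * B).
    have lt_m : (m < (2 * m).+1)%N by rewrite ltnS leq_pmull.
    by rewrite (big_cat_nat (leq0n m) (ltnW lt_m)) /= [in LHS](big_ltn lt_m).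
  have fk : \prod_(0 <= j < 2 * m) l k j = A * (l k m * B) / l k (2 * m)%N.
    by rewrite -full big_nat_recr//= mulfK.
  (* Moving [k] by [q] moves [j] by one, so this product lacks the factor [j = 0] where [fk] lacks
     [j = 2m]. *)
  have fkq : \prod_(0 <= j < 2 * m) l (k + q)%N j = A * (l k m * B) / l k 0%N.
    rewrite -full big_nat_recl//= mulrAC divff// mul1r.
    by apply: eq_bigr => j _; rewrite /l; congr (lucas _)%:R; ring.
  (* Subtraction is truncated: at [k = 0] the exponents [q - 1] and 0 would both be even. *)
  have sgn : (-1) ^+ (k + q - 1) = - (-1) ^+ (k - 1) :> R.
    by rewrite -addnBAC// exprD -[in (-1) ^+ q]signr_odd q_odd expr1 mulrN1.
  (* [lucas_mul] with $a = nk$ and $b = mnq$, where $b$ is even. *)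
  have numer : c * l k m = l k (2 * m)%N + l k 0%N.
    have := lucas_mul R (n * k) (m * n * q).
    rewrite -signr_odd [(m * n)%N]mulnC oddM (negbTE nm_even) expr0 mul1r.
    rewrite /c /l [(m * n)%N]mulnC muln0 mul0n addn0 => ->.
    by congr ((lucas _)%:R + _); ring.
  rewrite /f fk fkq sgn.
  (* Eliminating [l k (2 * m)] leaves an identity between independent quantities, within reach of
     [field]; the difference becomes a denominator, hence [h]. *)
  have -> : l k (2 * m)%N = c * l k m - l k 0%N by rewrite numer addrK.
  have h : c * l k m - l k 0%N != 0 by rewrite numer addrK.
  have := prod_neq0 k 0%N m; have := prod_neq0 k m.+1 (2 * m).+1.
  rewrite -/A -/B => B0 A0; field.
  by rewrite c_neq0 A0 B0 !l_neq0 h.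
have -> : (fun N : nat => \sum_(1 <= k < N.+1) ((-1) ^+ (k - 1)%N /
    ((\prod_(0 <= j < m) l k j) * (\prod_(m.+1 <= j < (2 * m).+1) l k j)))) =
    (fun N : nat => c^-1 * \sum_(1 <= k < N.+1) (f k - f (k + q)%N)).
  apply/funext => N; rewrite mulr_sumr.
  by apply: eq_big_nat => k /andP[k_gt0 _]; apply: term_eq.
rewrite div1r; apply: cvgMr; exact: cvg_telescope_step.
Qed.
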